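(* The following sixteen mesh patterns $(12,R)$ are pairwise equidistributed, where $R$ ranges over: $\{(0,2),(1,2),(2,2),(2,1),(0,0)\}$, $\{(0,2),(2,2),(0,1),(0,0),(1,0)\}$, $\{(1,2),(2,2),(2,1),(0,0),(2,0)\}$, $\{(2,2),(0,1),(0,0),(1,0),(2,0)\}$, $\{(0,2),(1,2),(2,2),(2,1),(1,0)\}$, $\{(0,2),(0,1),(2,1),(0,0),(1,0)\}$, $\{(1,2),(2,2),(0,1),(2,1),(2,0)\}$, $\{(1,2),(0,1),(0,0),(1,0),(2,0)\}$, $\{(0,2),(1,2),(2,2),(0,1),(2,0)\}$, $\{(0,2),(1,2),(0,1),(0,0),(2,0)\}$, $\{(0,2),(2,2),(2,1),(1,0),(2,0)\}$, $\{(0,2),(2,1),(0,0),(1,0),(2,0)\}$, $\{(0,2),(1,2),(2,2),(1,1),(2,0)\}$, $\{(0,2),(2,2),(1,1),(2,1),(2,0)\}$, $\{(0,2),(0,1),(1,1),(0,0),(2,0)\}$, $\{(0,2),(1,1),(0,0),(1,0),(2,0)\}$. Moreover, for each such pattern $p$ and each $n\ge1$, the number of permutations in $S_n$ avoiding $p$ is $(n-1)!\,(n-H_{n-1})$, where $H_m=\sum_{k=1}^m\frac1k$ is the $m$-th harmonic number ($H_0=0$).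
   Context: For $R\subseteq\{0,1,2\}^2$ and $\pi=\pi_1\cdots\pi_n\in S_n$, an occurrence of the mesh pattern $(12,R)$ in $\pi$ is a pair of positions $i_1<i_2$ with $\pi_{i_1}<\pi_{i_2}$ such that, setting $x_0=0,x_1=i_1,x_2=i_2,x_3=n+1$ and $y_0=0,y_1=\pi_{i_1},y_2=\pi_{i_2},y_3=n+1$, for every $(a,b)\in R$ there is no index $k$ with $x_a<k<x_{a+1}$ and $y_b<\pi_k<y_{b+1}$. A permutation avoids $p$ if it has no occurrence of $p$. $s_{n,k}(p)$ is the number of $\pi\in S_n$ with exactly $k$ occurrences of $p$; $p_1,p_2$ are equidistributed if $s_{n,k}(p_1)=s_{n,k}(p_2)$ for all $n,k\ge 0$. *)

(* Defs.v *)
From mathcomp Require Import all_boot all_order all_fingroup all_algebra.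

Set Implicit Arguments.
Unset Strict Implicit.
Unset Printing Implicit Defensive.

(* A shading R of {0,1,2}^2; it stands for the mesh pattern (12, R). *)
Definition shading := {set 'I_3 * 'I_3}.

Definition cells (c : seq (nat * nat)) : shading :=
  [set ab : 'I_3 * 'I_3 | (nat_of_ord ab.1, nat_of_ord ab.2) \in c].

(* Grid lines 0, u, v, n+1 of one axis, indexed by a = 0, 1, 2, 3. *)
Definition grid_line (n u v a : nat) : nat := nth 0 [:: 0; u; v; n.+1] a.

(* Permutations in 'S_n act on {0, ..., n-1}, hence the successors: the
   ordinal i is the position i+1, and its entry is (s i)+1. *)
Definition in_cell (n : nat) (s : 'S_n) (i1 i2 : 'I_n) (ab : 'I_3 * 'I_3)
    (k : 'I_n) : bool :=
  let x := grid_line n i1.+1 i2.+1 in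
  let y := grid_line n (s i1).+1 (s i2).+1 in
  (x ab.1 < k.+1 < x ab.1.+1) && (y ab.2 < (s k).+1 < y ab.2.+1).

Definition occurrence (R : shading) (n : nat) (s : 'S_n) (i1 i2 : 'I_n) : bool :=
  [&& i1 < i2, s i1 < s i2 &
      [forall ab in R, ~~ [exists k : 'I_n, in_cell s i1 i2 ab k]]].

Definition occurrences (R : shading) (n : nat) (s : 'S_n) : {set 'I_n * 'I_n} :=
  [set i : 'I_n * 'I_n | occurrence R s i.1 i.2].

Definition avoids (R : shading) (n : nat) (s : 'S_n) : bool :=
  ~~ [exists i1 : 'I_n, exists i2 : 'I_n, occurrence R s i1 i2].

Definition num_perms (R : shading) (n k : nat) : nat :=
  #|[set s : 'S_n | #|occurrences R s| == k]|.

Definition equidistributed (R1 R2 : shading) : Prop :=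
  forall n k : nat, num_perms R1 n k = num_perms R2 n k.

Definition harmonic (m : nat) : rat := (\sum_(1 <= k < m.+1) k%:R^-1)%R.

Definition sixteen_shadings : seq shading :=
  [:: cells [:: (0,2); (1,2); (2,2); (2,1); (0,0)];
      cells [:: (0,2); (2,2); (0,1); (0,0); (1,0)];
      cells [:: (1,2); (2,2); (2,1); (0,0); (2,0)];
      cells [:: (2,2); (0,1); (0,0); (1,0); (2,0)];
      cells [:: (0,2); (1,2); (2,2); (2,1); (1,0)];
      cells [:: (0,2); (0,1); (2,1); (0,0); (1,0)];
      cells [:: (1,2); (2,2); (0,1); (2,1); (2,0)];
      cells [:: (1,2); (0,1); (0,0); (1,0); (2,0)];
      cells [:: (0,2); (1,2); (2,2); (0,1); (2,0)];
      cells [:: (0,2); (1,2); (0,1); (0,0); (2,0)];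
      cells [:: (0,2); (2,2); (2,1); (1,0); (2,0)];
      cells [:: (0,2); (2,1); (0,0); (1,0); (2,0)];
      cells [:: (0,2); (1,2); (2,2); (1,1); (2,0)];
      cells [:: (0,2); (2,2); (1,1); (2,1); (2,0)];
      cells [:: (0,2); (0,1); (1,1); (0,0); (2,0)];
      cells [:: (0,2); (1,1); (0,0); (1,0); (2,0)]].

(* Main.v *)
(* All sixteen shadings are linked by four bijections of permutations: inversion
   (transposes the cells), reverse-complement (rotates them), and, when the top
   row is shaded, so that the larger entry of an occurrence must be the maximum:
   reversing the prefix before the maximum (swaps the columns 0 and 1) and
   complementing the values below the maximum (swaps the rows 0 and 1).

   For {(0,2),(1,2),(2,2),(0,1),(2,0)}, an occurrence is a left-to-right maximum
   before n which is smaller than all entries after n. It exists iff the first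
   entry j is not n and the entries 1, ..., j-1 all precede n. By symmetry, n is
   last among these j values in a fraction 1/j of the (n-1)! permutations that
   start with j, so (n-1)! H_(n-1) permutations have an occurrence. *)

Require Import Defs.
From mathcomp Require Import all_boot all_order all_fingroup all_algebra.
From mathcomp Require Import zify.

Set Implicit Arguments.
Unset Strict Implicit.
Unset Printing Implicit Defensive.

(** * Empty cells and transfer of equidistribution along bijections *)

Definition cell_empty (n : nat) (s : 'S_n) (i1 i2 : 'I_n) (ab : nat * nat) : bool :=
  let x := grid_line n i1.+1 i2.+1 in
  let y := grid_line n (s i1).+1 (s i2).+1 in
  [forall k : 'I_n, ~~ ((x ab.1 < k.+1 < x ab.1.+1)
                        && (y ab.2 < (s k).+1 < y ab.2.+1))].

Definition in_grid (c : seq (nat * nat)) : bool :=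
  all (fun ab => (ab.1 < 3) && (ab.2 < 3)) c.

(** Listing the cells as pairs of numbers lets the symmetries act on shadings by [map] and
    compute. *)
Lemma occurrence_cells (c : seq (nat * nat)) (n : nat) (s : 'S_n) (i1 i2 : 'I_n) :
  in_grid c ->
  occurrence (cells c) s i1 i2 =
  [&& i1 < i2, s i1 < s i2 & all (cell_empty s i1 i2) c].
Proof.
move=> /allP c3; congr [&& _, _ & _]; apply/forallP/allP => [H ab abc | H [a b]].
  have /andP[a3 b3] := c3 _ abc.
  have := H (Ordinal a3, Ordinal b3); rewrite inE /= -surjective_pairing abc /=.
  by rewrite negb_exists.
by rewrite inE /= negb_exists; apply/implyP => /H.
Qed.

Lemma eq_cells (c c' : seq (nat * nat)) : c =i c' -> cells c = cells c'.
Proof. by move=> cc'; apply/setP => ab; rewrite !inE cc'. Qed.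

Lemma equidistributed_trans (R1 R2 R3 : shading) :
  equidistributed R1 R2 -> equidistributed R2 R3 -> equidistributed R1 R3.
Proof. by move=> E12 E23 n k; rewrite E12 E23. Qed.

(** An injection of a finite set into itself is bijective, so preimages under [g] and [h] keep
    cardinalities. Sizes are [n.+1] so that [ord_max] exists; in size 0 there are no pairs of
    positions. *)
Lemma equidistributed_bij (R1 R2 : shading)
    (g : forall n, 'S_n.+1 -> 'S_n.+1)
    (h : forall n, 'S_n.+1 -> 'I_n.+1 * 'I_n.+1 -> 'I_n.+1 * 'I_n.+1) :
  (forall n, injective (@g n)) -> (forall n (s : 'S_n.+1), injective (h n s)) ->
  (forall n (s : 'S_n.+1) i1 i2, occurrence R1 s i1 i2 =
     occurrence R2 (g n s) (h n s (i1, i2)).1 (h n s (i1, i2)).2) ->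
  equidistributed R1 R2.
Proof.
move=> g_inj h_inj E [|n] k; rewrite /num_perms.
  by apply: eq_card => s; rewrite !inE; congr (_ == k); apply: eq_card => -[[]].
suff -> : [set s : 'S_n.+1 | #|occurrences R1 s| == k] =
          @g n @^-1: [set s : 'S_n.+1 | #|occurrences R2 s| == k].
  by rewrite card_preimset; last exact: g_inj n.
apply/setP => s; rewrite !inE; congr (_ == k).
suff -> : occurrences R1 s = h n s @^-1: occurrences R2 (g n s).
  by rewrite card_preimset; last exact: h_inj n s.
by apply/setP => -[i1 i2]; rewrite !inE E.
Qed.

(** * Inversion and reverse-complement *)

Lemma equidistributed_transpose (c : seq (nat * nat)) :
  in_grid c -> equidistributed (cells c) (cells [seq (ab.2, ab.1) | ab <- c]).
Proof.
move=> c3.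
apply: (@equidistributed_bij _ _ (fun n s => s^-1)%g
          (fun n (s : 'S_n.+1) i => (s i.1, s i.2))) => [n|n s|n s i1 i2 /=].
- exact: invg_inj.
- by move=> [i1 i2] [j1 j2] /= [/perm_inj -> /perm_inj ->].
rewrite !occurrence_cells //; last first.
  by rewrite /in_grid all_map; apply: sub_all c3 => ab /=; rewrite andbC.
rewrite !permK andbCA all_map; congr [&& _, _ & _].
apply: eq_all => -[a b] /=; rewrite /cell_empty !permK /=.
apply/forallP/forallP => H k; first by rewrite andbC; have := H (s^-1 k)%g; rewrite permKV.
by rewrite andbC; have := H (s k); rewrite permK.
Qed.

Definition revcomp (n : nat) (s : 'S_n) : 'S_n :=
  perm (inj_comp (@rev_ord_inj n) (inj_comp (@perm_inj _ s) (@rev_ord_inj n))).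

Lemma revcompE (n : nat) (s : 'S_n) (i : 'I_n) : revcomp s i = rev_ord (s (rev_ord i)).
Proof. by rewrite permE. Qed.

Lemma revcompK (n : nat) : involutive (@revcomp n).
Proof. by move=> s; apply/permP => i; rewrite !revcompE !rev_ordK. Qed.

Lemma equidistributed_revcomp (c : seq (nat * nat)) :
  in_grid c -> equidistributed (cells c) (cells [seq (2 - ab.1, 2 - ab.2) | ab <- c]).
Proof.
move=> c3.
apply: (@equidistributed_bij _ _ (fun n => @revcomp n.+1)
          (fun n (s : 'S_n.+1) i => (rev_ord i.2, rev_ord i.1))) => [n|n s|n s i1 i2 /=].
- exact: inv_inj (@revcompK n.+1).
- move=> [i1 i2] [j1 j2] /= /eqP; rewrite xpair_eqE !(inj_eq (@rev_ord_inj n.+1)).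
  by move=> /andP[/eqP -> /eqP ->].
rewrite !occurrence_cells //; last first.
  by rewrite /in_grid all_map; apply: sub_all c3 => ab /=; lia.
rewrite !revcompE !rev_ordK all_map; congr [&& _, _ & _].
- by have := ltn_ord i1; have := ltn_ord i2; rewrite /=; lia.
- by have := ltn_ord (s i1); have := ltn_ord (s i2); rewrite /=; lia.
apply: eq_in_all => -[a b] /(allP c3) /= /andP[a3 b3].
pose x := grid_line n.+1 i1.+1 i2.+1.
pose y := grid_line n.+1 (s i1).+1 (s i2).+1.
pose x' := grid_line n.+1 (rev_ord i2).+1 (rev_ord i1).+1.
pose y' := grid_line n.+1 (rev_ord (s i2)).+1 (rev_ord (s i1)).+1.
(* Reflection sends grid line [a] to grid line [3 - a], hence the strip between lines [a] and [a.+1]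
   to strip [2 - a]. *)
have E (k : 'I_n.+1) :
    (x a < k.+1 < x a.+1) && (y b < (s k).+1 < y b.+1)
  = (x' (2 - a) < (rev_ord k).+1 < x' (2 - a).+1)
    && (y' (2 - b) < (rev_ord (s k)).+1 < y' (2 - b).+1).
  have := ltn_ord i1; have := ltn_ord i2; have := ltn_ord k.
  have := ltn_ord (s i1); have := ltn_ord (s i2); have := ltn_ord (s k).
  by case: a a3 => [|[|[|//]]] _; case: b b3 => [|[|[|//]]] _;
    rewrite /x /x' /y /y' /grid_line /=; lia.
rewrite /cell_empty !revcompE !rev_ordK -/x -/x' -/y -/y' /=.
apply/forallP/forallP => H k.
  by rewrite revcompE; have := H (rev_ord k); rewrite E rev_ordK.
by rewrite E; have := H (rev_ord k); rewrite revcompE rev_ordK.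
Qed.

(** * Swapping columns or rows next to the maximum *)

Definition reverse_below (n : nat) (p k : 'I_n) : 'I_n :=
  insubd k (if k < p then p.-1 - k else k).

(** Both branches are smaller than [n], so [insubd] never falls back on its default. *)
Lemma reverse_belowE (n : nat) (p k : 'I_n) :
  reverse_below p k = (if k < p then p.-1 - k else k) :> nat.
Proof.
rewrite val_insubd; have := ltn_ord p; have := ltn_ord k.
by case: (ltnP k p) => kp; case: ifP => //; lia.
Qed.

Lemma reverse_belowK (n : nat) (p : 'I_n) : involutive (reverse_below p).
Proof.
by move=> k; apply/val_inj; rewrite /= !reverse_belowE; case: (ltnP k p); case: ifP; lia.
Qed.

Lemma reverse_below_id (n : nat) (p : 'I_n) : reverse_below p p = p.
Proof. by apply/val_inj; rewrite /= reverse_belowE ltnn. Qed.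

Definition reverse_below_perm (n : nat) (p : 'I_n) : 'S_n :=
  perm (inv_inj (reverse_belowK p)).

Definition swap01 (a : nat) : nat := if a < 2 then 1 - a else a.

Lemma swap01_lt3 (a : nat) : (swap01 a < 3) = (a < 3).
Proof. by rewrite /swap01; case: ifP; lia. Qed.

Definition top_row (c : seq (nat * nat)) : bool := all (mem c) [:: (0, 2); (1, 2); (2, 2)].

Lemma top_row_map (c : seq (nat * nat)) (f : nat * nat -> nat * nat) :
  perm_eq (map f [:: (0, 2); (1, 2); (2, 2)]) [:: (0, 2); (1, 2); (2, 2)] ->
  top_row c -> top_row (map f c).
Proof.
move=> /perm_mem ftop /allP ctop; apply/allP => ab; rewrite -ftop => /mapP[x /ctop xc ->].
exact: map_f.
Qed.

(** Otherwise the maximum would stand above [s i2], in one of the three shaded cells of row 2. *)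
Lemma top_row_occurrence (c : seq (nat * nat)) (n : nat) (s : 'S_n.+1) (i1 i2 : 'I_n.+1) :
  in_grid c -> top_row c -> occurrence (cells c) s i1 i2 -> s i2 = ord_max.
Proof.
move=> c3 ctop; rewrite occurrence_cells // => /and3P[lt_i lt_s /allP ce].
have ek a : a < 3 -> cell_empty s i1 i2 (a, 2).
  by move=> a3; apply/ce/(allP ctop); case: a a3 => [|[|[|]]].
apply/eqP; apply: contraLR lt_s => s2.
have sk := permKV s ord_max; set k := (s^-1 ord_max)%g in sk.
have k2 : k <> i2 by move=> E; rewrite -E sk eqxx in s2.
have s2n : s i2 < n.
  by rewrite ltn_neqAle -ltnS ltn_ord andbT; apply: contra s2 => /eqP E; apply/eqP/val_inj.
have := ltn_ord k; have := ltn_ord i2; have := ltn_ord (s i2).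
case: (ltngtP k i1) => [k1|k1|/val_inj <-]; last by rewrite sk /=; lia.
  by have := forallP (ek 0 isT) k; rewrite /grid_line /= sk /=; lia.
case: (ltngtP k i2) => [kk|kk|/val_inj]; last by [].
  by have := forallP (ek 1 isT) k; rewrite /grid_line /= sk /=; lia.
by have := forallP (ek 2 isT) k; rewrite /grid_line /= sk /=; lia.
Qed.

Definition reverse_before_max (n : nat) (s : 'S_n.+1) : 'S_n.+1 :=
  (reverse_below_perm (s^-1 ord_max) * s)%g.

Lemma reverse_before_maxE (n : nat) (s : 'S_n.+1) (i : 'I_n.+1) :
  reverse_before_max s i = s (reverse_below (s^-1 ord_max)%g i).
Proof. by rewrite permM permE. Qed.

Lemma reverse_before_max_pos (n : nat) (s : 'S_n.+1) :
  ((reverse_before_max s)^-1 ord_max = s^-1 ord_max)%g.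
Proof.
by apply: (@perm_inj _ (reverse_before_max s)); rewrite permKV reverse_before_maxE
  reverse_below_id permKV.
Qed.

Lemma reverse_before_maxK (n : nat) : involutive (@reverse_before_max n).
Proof.
move=> s; apply/permP => i.
by rewrite !reverse_before_maxE reverse_before_max_pos reverse_belowK.
Qed.

(** The second position of an occurrence is that of the maximum, which the reversal fixes. Reversing
    the prefix exchanges the positions left of [i1] with those between [i1] and the maximum, and
    entries keep their values. *)
Lemma equidistributed_swap_columns (c : seq (nat * nat)) :
  in_grid c -> top_row c ->
  equidistributed (cells c) (cells [seq (swap01 ab.1, ab.2) | ab <- c]).
Proof.
move=> c3 ctop.
pose h n (s : 'S_n.+1) := reverse_below (s^-1 ord_max)%g.
apply: (@equidistributed_bij _ _ reverse_before_max
          (fun n s i => (h n s i.1, h n s i.2))) => [n|n s|n s i1 i2 /=].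
- exact: inv_inj (@reverse_before_maxK n).
- move=> [i1 i2] [j1 j2] /= /eqP; rewrite xpair_eqE !(inj_eq (inv_inj (reverse_belowK _))).
  by move=> /andP[/eqP -> /eqP ->].
have c3' : in_grid [seq (swap01 ab.1, ab.2) | ab <- c].
  by rewrite /in_grid all_map; apply: sub_all c3 => ab /=; rewrite swap01_lt3.
have ctop' : top_row [seq (swap01 ab.1, ab.2) | ab <- c] by exact: top_row_map.
(* If [s i2] is not the maximum, neither side is an occurrence. *)
have [s2|s2] := eqVneq (s i2) ord_max; last first.
  apply/idP/idP => /top_row_occurrence H; first by rewrite H // eqxx in s2.
  have := H c3' ctop'; rewrite reverse_before_maxE reverse_belowK => E.
  by rewrite E eqxx in s2.
have {s2} <- : (s^-1 ord_max)%g = i2 by rewrite -s2 permK.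
rewrite !occurrence_cells // /h reverse_below_id !reverse_before_maxE.
rewrite reverse_belowK reverse_below_id.
set p := (s^-1 ord_max)%g.
rewrite [reverse_below p i1 < p](_ : _ = (i1 < p));
  last by rewrite reverse_belowE; case: ifP; lia.
apply: andb_id2l => lt_i; congr (_ && _); rewrite all_map.
apply: eq_in_all => -[a b] /(allP c3) /= /andP[a3 _].
pose x := grid_line n.+1 i1.+1 p.+1.
pose x' := grid_line n.+1 (reverse_below p i1).+1 p.+1.
have E (k : 'I_n.+1) : (x a < k.+1 < x a.+1)
  = (x' (swap01 a) < (reverse_below p k).+1 < x' (swap01 a).+1).
  rewrite /x /x' !reverse_belowE lt_i; have := ltn_ord k; have := ltn_ord p; move: lt_i.
  by case: a a3 => [|[|[|//]]] _; rewrite /grid_line /=; case: ifP; lia.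
rewrite /cell_empty !reverse_before_maxE -/p reverse_belowK reverse_below_id -/x -/x' /=.
apply/forallP/forallP => H k.
  by rewrite reverse_before_maxE; have := H (reverse_below p k); rewrite E reverse_belowK.
by rewrite E; have := H (reverse_below p k); rewrite reverse_before_maxE reverse_belowK.
Qed.

Definition complement_below_max (n : nat) (s : 'S_n.+1) : 'S_n.+1 :=
  (s * reverse_below_perm ord_max)%g.

Lemma complement_below_maxE (n : nat) (s : 'S_n.+1) (i : 'I_n.+1) :
  complement_below_max s i = reverse_below ord_max (s i).
Proof. by rewrite permM permE. Qed.

(** Complementing exchanges the values under [s i1] with those between [s i1] and the maximum.
    Positions stay, so pairs of positions are mapped by the identity. *)
Lemma equidistributed_swap_rows (c : seq (nat * nat)) :
  in_grid c -> top_row c ->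
  equidistributed (cells c) (cells [seq (ab.1, swap01 ab.2) | ab <- c]).
Proof.
move=> c3 ctop.
apply: (@equidistributed_bij _ _ complement_below_max (fun n s i => i))
  => [n|n s [] |n s i1 i2 /=].
- exact: mulIg.
- by [].
have c3' : in_grid [seq (ab.1, swap01 ab.2) | ab <- c].
  by rewrite /in_grid all_map; apply: sub_all c3 => ab /=; rewrite swap01_lt3.
have ctop' : top_row [seq (ab.1, swap01 ab.2) | ab <- c] by exact: top_row_map.
have [s2|s2] := eqVneq (s i2) ord_max; last first.
  apply/idP/idP => /top_row_occurrence H; first by rewrite H // eqxx in s2.
  have := H c3' ctop'; rewrite complement_below_maxE -[RHS]reverse_below_id.
  by move/(inv_inj (reverse_belowK _)) => E; rewrite E eqxx in s2.
rewrite !occurrence_cells // !complement_below_maxE s2 reverse_below_id.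
congr (_ && _).
rewrite [reverse_below _ (s i1) < _](_ : _ = (s i1 < ord_max (n' := n)));
  last by rewrite reverse_belowE; case: ifP; lia.
apply: andb_id2l => lt_s; rewrite all_map.
apply: eq_in_all => -[a b] /(allP c3) /= /andP[_ b3].
rewrite /cell_empty !complement_below_maxE s2 reverse_below_id /=.
apply: eq_forallb => k; congr (~~ (_ && _)); rewrite complement_below_maxE.
rewrite !reverse_belowE lt_s; have := ltn_ord (s k); move: lt_s => /=.
by case: b b3 => [|[|[|//]]] _; rewrite /grid_line /=; case: ifP; lia.
Qed.

(** * The orbits of the sixteen shadings *)

Lemma equidistributed_orbit (R : shading) (c d : seq (nat * nat)) :
  equidistributed R (cells c) -> in_grid c ->
  let tr := map (fun ab => (ab.2, ab.1)) in
  let rc := map (fun ab => (2 - ab.1, 2 - ab.2)) in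
  [|| perm_eq d c, perm_eq d (tr c), perm_eq d (rc c) | perm_eq d (rc (tr c))] ->
  equidistributed R (cells d).
Proof.
move=> Rc c3 tr rc.
have trc3 : in_grid (tr c).
  by rewrite /in_grid all_map; apply: sub_all c3 => ab /=; rewrite andbC.
have Rtr := equidistributed_trans Rc (equidistributed_transpose c3).
by case/or4P => /perm_mem/eq_cells -> //;
  [exact: equidistributed_trans Rc (equidistributed_revcomp c3)
  |exact: equidistributed_trans Rtr (equidistributed_revcomp trc3)].
Qed.

Definition base_cells : seq (nat * nat) := [:: (0,2); (1,2); (2,2); (0,1); (2,0)].

Lemma equidistributed_sixteen (R : shading) :
  R \in sixteen_shadings -> equidistributed (cells base_cells) R.
Proof.
have E0 : equidistributed (cells base_cells) (cells base_cells) by [].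
have Ec := equidistributed_swap_columns (c := base_cells) isT isT.
have Er := equidistributed_swap_rows (c := base_cells) isT isT.
have Erc := equidistributed_trans Er
  (equidistributed_swap_columns (c := [seq (ab.1, swap01 ab.2) | ab <- base_cells]) isT isT).
(* Four blocks of four consecutive shadings are the orbits under inversion and reverse-complement:
   [Er] reaches the first block, [Erc] the second, [E0] the third and [Ec] the fourth. *)
rewrite !inE; do 15?[case/orP => [/eqP ->|]]; try move/eqP ->;
  first [apply: (equidistributed_orbit E0 isT); exact: isT
           |apply: (equidistributed_orbit Ec isT); exact: isT
           |apply: (equidistributed_orbit Er isT); exact: isT
           |apply: (equidistributed_orbit Erc isT); exact: isT].
Qed.

(** * Avoidance of the base pattern *)

Lemma avoidsE (R : shading) (n : nat) (s : 'S_n) :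
  avoids R s = (#|occurrences R s| == 0).
Proof.
rewrite /avoids cards_eq0; apply/idP/eqP => [|H].
  move=> /existsPn H; apply/setP => -[i1 i2]; rewrite !inE.
  by have /existsPn/(_ i2) := H i1; apply: negbTE.
apply/existsPn => i1; apply/existsPn => i2.
by have := in_set0 (i1, i2); rewrite -H inE /= => ->.
Qed.

(* If [s] has an occurrence of the pattern with shading [cells base_cells],
   then [ord0] and the position of the maximum already form one. *)
Definition late_max (n : nat) (s : 'S_n.+1) : bool :=
  (s ord0 != ord_max) &&
  [forall u : 'I_n.+1, (u < s ord0) ==> ((s^-1)%g u <= (s^-1)%g ord_max)].

Lemma avoids_base (n : nat) (s : 'S_n.+1) :
  avoids (cells base_cells) s = ~~ late_max s.
Proof.
rewrite /avoids; congr (~~ _).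
have sp := permKV s ord_max; set p := (s^-1 ord_max)%g in sp.
apply/existsP/andP => [[i1 /existsP[i2 occ]]|[s0 /forallP late]].
  have sM := top_row_occurrence (c := base_cells) isT isT occ.
  have {sM} ? : i2 = p by rewrite /p -sM permK.
  subst i2; move: occ; rewrite occurrence_cells // sp => /and3P[lt_i lt_s].
  case/and5P=> _ _ _ /forallP e01 /andP[/forallP e20 _].
  (* Cell (0,1) is empty and [s i2] is the maximum, so the first entry, which is not the maximum,
     cannot exceed [s i1]. *)
  have s01 : s ord0 <= s i1.
    have := e01 ord0; rewrite /grid_line /= sp /=.
    have := ltn_ord (s ord0).
    have [->//|i0] := eqVneq ord0 i1.
    have : 0 < i1 by rewrite lt0n; apply: contra i0 => /eqP E; apply/eqP/val_inj.
    have : s ord0 != ord_max.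
      rewrite -sp (inj_eq perm_inj) -val_eqE /=; lia.
    rewrite -val_eqE /=; lia.
  split.
    by rewrite -val_eqE /=; move: lt_s => /=; lia.
  apply/forallP => u; apply/implyP => us.
  (* As [u] is below [s i1], the empty cell (2,0) forbids it after the maximum. *)
  have := e20 (s^-1 u)%g; rewrite /grid_line /= permKV -/p.
  have := ltn_ord (s^-1 u)%g; lia.
have p0 : 0 < p.
  rewrite lt0n; apply: contra s0 => /eqP E.
  by rewrite -sp (_ : p = ord0) //; apply/val_inj.
(* Nothing precedes [ord0] and nothing exceeds the maximum, so column 0 and row 2 are empty; [late]
   empties cell (2,0). *)
exists ord0; apply/existsP; exists p.
rewrite occurrence_cells // sp p0 /=.
have s0n : s ord0 < n.
  by rewrite ltn_neqAle -ltnS ltn_ord andbT -[n]/(val (@ord_max n)) val_eqE.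
rewrite s0n /=; apply/and5P; split; [| | | |rewrite andbT];
  apply/forallP => k; rewrite /grid_line /= ?sp /=;
  have := ltn_ord (s k); try lia.
have := late (s k); rewrite permK -/p implybE; lia.
Qed.

(** * Counting permutations by their first entry *)

Lemma card_value_at (n : nat) (x j : 'I_n) : n * #|[set s : 'S_n | s x == j]| = n`!.
Proof.
rewrite -[RHS](card_Sn n) -[in RHS]sum1_card.
rewrite (partition_big (fun s : 'S_n => s x) predT) //=.
under eq_bigr => i _.
  rewrite sum1_card (_ : #|_| = #|[set s : 'S_n | s x == j]|); first over.
  (* Exchanging the values [i] and [j] matches the permutations with value [i] at [x] to those with
     value [j] there. *)
  rewrite -(card_preimset _ (mulIg (tperm i j))); apply: eq_card => s.
  by rewrite !inE permM -[X in _ = (_ == X)](tpermL i j) (inj_eq perm_inj).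
by rewrite sum_nat_const card_ord.
Qed.

(* Composing with the transposition of two values of [T] shows that each value
   of [T] is equally often the rightmost one. *)
Lemma card_value_at_last (n : nat) (x j : 'I_n) (T : {set 'I_n}) (t : 'I_n) :
  t \in T -> j \notin T ->
  #|T| * #|[set s : 'S_n | (s x == j) && [forall u in T, (s^-1)%g u <= (s^-1)%g t]]|
    = #|[set s : 'S_n | s x == j]|.
Proof.
move=> tT jT.
pose E v := [set s : 'S_n | (s x == j) && [forall u in T, (s^-1)%g u <= (s^-1)%g v]].
have cE v : v \in T -> #|E v| = #|E t|.
  move=> vT; rewrite -(card_preimset _ (mulIg (tperm v t))); apply: eq_card => s.
  have jE : tperm v t j = j.
    by rewrite tpermD //; apply: contraNneq jT => <-.
  rewrite !inE permM -[X in (_ == X) && _ = _]jE (inj_eq perm_inj); congr (_ && _).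
  have TE u : (tperm v t u \in T) = (u \in T) by case: tpermP => [->|->|//]; rewrite ?vT ?tT.
  apply/forall_inP/forall_inP => H u uT.
    have := H (tperm v t u); rewrite TE => /(_ uT).
    by rewrite invMg tpermV !permM tpermL tpermK.
  by rewrite invMg tpermV !permM tpermL H // TE.
have -> : #|T| * #|E t| = \sum_(v in T) #|E v|.
  by rewrite (eq_bigr (fun=> #|E t|)) ?sum_nat_const.
under eq_bigr => v _ do rewrite -sum1dep_card big_mkcondr.
rewrite exchange_big /= -sum1dep_card; apply: eq_bigr => s _.
(* After exchanging the sums, each permutation is counted for exactly one [v], the rightmost value
   of [T]. *)
pose m := [arg max_(v > t in T) (s^-1)%g v].
have [mT mmax] : m \in T /\ forall u, u \in T -> (s^-1)%g u <= (s^-1)%g m.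
  by rewrite /m; case: arg_maxnP.
rewrite (bigD1 m) //= big1 ?addn0 => [|v /andP[vT vm]].
  by rewrite ifT //; apply/forall_inP.
case: forall_inP => // /(_ m mT) le_mv.
case/eqP: vm; apply: (@perm_inj _ (s^-1)%g); apply/val_inj/eqP.
by rewrite eqn_leq le_mv mmax.
Qed.

(** With first entry [j], [late_max] says that the maximum comes last among itself and the [j]
    values below [j]. These [j.+1] values are equally likely to come last. *)
Lemma card_late_max_at (n : nat) (j : 'I_n.+1) : j < n ->
  j.+1 * #|[set s : 'S_n.+1 | late_max s & s ord0 == j]| = n`!.
Proof.
move=> jn.
have c0 : #|[set s : 'S_n.+1 | s ord0 == j]| = n`!.
  by apply/eqP; rewrite -(eqn_pmul2l (ltn0Sn n)) -factS card_value_at.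
pose T : {set 'I_n.+1} := ord_max |: [set u : 'I_n.+1 | u < j].
have TM : ord_max \in T by rewrite setU11.
have jT : j \notin T by rewrite !inE ltnn orbF -val_eqE /=; lia.
have cT : #|T| = j.+1.
  rewrite cardsU1 inE /= ltnNge ltnW //= add1n; congr _.+1.
  have -> : #|[set u : 'I_n.+1 | u < j]| = \sum_(u < n.+1 | u < j) 1.
    by rewrite -sum1dep_card.
  by rewrite -(big_ord_widen n.+1 (fun=> 1)) ?sum1_card ?card_ord // ltnW.
rewrite -c0 -(card_value_at_last ord0 TM jT) cT; congr (_ * _).
apply: eq_card => s; rewrite !inE andbC; apply: andb_id2l => /eqP sj.
rewrite /late_max sj -val_eqE /= neq_ltn jn /=.
apply/forallP/forall_inP => H u; rewrite ?inE.
  by case/orP => [/eqP->//|uj]; have := H u; rewrite uj.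
by apply/implyP => uj; apply: H; rewrite !inE uj orbT.
Qed.

(** * The harmonic sum and the count of avoiders *)

Import GRing.Theory Num.Theory.

Lemma card_late_max (n : nat) :
  (#|[set s : 'S_n.+1 | late_max s]|%:R = n`!%:R * harmonic n :> rat)%R.
Proof.
rewrite -sum1dep_card (partition_big (fun s : 'S_n.+1 => s ord0) predT) //=.
(* The first entry [ord_max] contributes nothing, since [late_max] excludes it. *)
rewrite big_ord_recr /= [X in _ + X]big1 ?addn0; last first.
  by move=> s /andP[/andP[/negbTE->]].
rewrite natr_sum /harmonic big_add1 /= big_mkord mulr_sumr.
apply: eq_bigr => j _; rewrite sum1dep_card.
have := card_late_max_at (j := widen_ord (leqnSn n) j) (ltn_ord j) => <-.
by rewrite natrM mulrAC mulfV ?mul1r // pnatr_eq0.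
Qed.

Lemma card_avoids_base (n : nat) :
  (#|[set s : 'S_n.+1 | avoids (cells base_cells) s]|%:R
     = n`!%:R * (n.+1%:R - harmonic n) :> rat)%R.
Proof.
rewrite mulrBr -card_late_max -natrM mulnC -factS -(card_Sn n.+1).
rewrite -(cardsC [set s : 'S_n.+1 | late_max s]) natrD addrAC subrr add0r.
by congr _%:R%R; apply: eq_card => s; rewrite !inE avoids_base.
Qed.

Theorem theorem3p11 :
  (forall R1 R2 : shading, R1 \in sixteen_shadings -> R2 \in sixteen_shadings ->
     equidistributed R1 R2)
  /\
  (forall R : shading, R \in sixteen_shadings ->
     forall n : nat, 1 <= n ->
       (#|[set s : 'S_n | avoids R s]|%:R
          = (n.-1)`!%:R * (n%:R - harmonic n.-1) :> rat)%R).
Proof.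
split=> [R1 R2 /equidistributed_sixteen E1 /equidistributed_sixteen E2 n k|].
  by rewrite -E1 E2.
move=> R /equidistributed_sixteen E [//|n] _.
rewrite -card_avoids_base; congr _%:R%R.
(* Avoiders are the permutations with 0 occurrences, so equidistribution transfers the count. *)
have := E n.+1 0; rewrite /num_perms.
under eq_finset => s do rewrite -avoidsE.
by move=> ->; apply: eq_card => s; rewrite !inE avoidsE.
Qed.
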